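(* Let $n,d\ge1$, let $X_1,\dots,X_n\in\mathbb{R}^d$, $X_i=(X_{i1},\dots,X_{id})$, let $\Sigma_1,\dots,\Sigma_n$ be $d\times d$ symmetric positive-definite matrices, and let $\mathcal{M}$ be the ridgeline manifold of $(X_i,\Sigma_i)_{i=1}^n$ (which contains the support of every maximizer $\widehat G_n$ of $G\mapsto\frac1n\sum_{i=1}^n\log f_{G,\Sigma_i}(X_i)$ over $\mathcal{P}(\mathbb{R}^d)$). 1. If $\Sigma_i=\Sigma$ for all $i$, or more generally if $\Sigma_i=c_i\Sigma$ for all $i$ for some positive scalars $c_1,\dots,c_n$ and a positive-definite $\Sigma$, then $\mathcal{M}=\mathrm{conv}(\{X_1,\dots,X_n\})$. 2. If $\Sigma_i$ is a diagonal matrix for every $i$, then $$\mathcal{M}\subseteq\prod_{j=1}^d\Big[\min_{1\le i\le n}X_{ij},\ \max_{1\le i\le n}X_{ij}\Big].$$ 3. Let $\overline k\ge\underline k>0$ be such that $\underline kI_d\preceq\Sigma_i\preceq\overline kI_d$ for all $i$, and let $r>0$ and $x_0\in\mathbb{R}^d$ be such that $\|X_i-x_0\|_2\le r$ for all $i$. Then $$\mathcal{M}\subseteq\{y\in\mathbb{R}^d:\|y-x_0\|_2\le\kappa r\},\qquad\kappa=\overline k/\underline k .$$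
   Context: The ridgeline manifold of $(X_i,\Sigma_i)_{i=1}^n$ is $\mathcal{M}=\{x^*(\alpha):\alpha\in\Delta_{n-1}\}$ with $x^*(\alpha)=\big(\sum_{i=1}^n\alpha_i\Sigma_i^{-1}\big)^{-1}\sum_{i=1}^n\alpha_i\Sigma_i^{-1}X_i$ and $\Delta_{n-1}=\{\alpha\in\mathbb{R}^n:\alpha_i\ge0,\ \sum_i\alpha_i=1\}$. $A\preceq B$ means $B-A$ is symmetric positive semidefinite; $\mathrm{conv}$ is the convex hull. $\mathcal{P}(\mathbb{R}^d)$ is the set of Borel probability measures on $\mathbb{R}^d$, and $f_{G,\Sigma}(x)=\int\varphi_\Sigma(x-\theta)\,dG(\theta)$ with $\varphi_\Sigma$ the $\mathcal{N}(0,\Sigma)$ density. *)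

(* Defs.v *)
(* MathComp / MathComp-Analysis. *)
From HB Require Import structures.
From mathcomp Require Import all_boot all_order all_algebra.
From mathcomp Require Import all_classical all_reals all_analysis.
Import Order.TTheory GRing.Theory Num.Theory.
Import numFieldNormedType.Exports.

Set Implicit Arguments.
Unset Strict Implicit.
Unset Printing Implicit Defensive.

Local Open Scope classical_set_scope.
Local Open Scope ring_scope.

(* Points of R^d are column vectors 'cV[R]_d. *)

Section Matrices.
Context {R : realType} {d : nat}.
Implicit Types (A B : 'M[R]_d) (v : 'cV[R]_d).

Definition qform A v : R := (v^T *m A *m v) 0 0.

Definition posdef A : Prop := A^T = A /\ forall v, v != 0 -> 0 < qform A v.

Definition possemidef A : Prop := A^T = A /\ forall v, 0 <= qform A v.

Definition loewner_le A B : Prop := possemidef (B - A).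

(* The library norm on matrices is the sup norm. *)
Definition enorm v : R := Num.sqrt (\sum_j v j 0 ^+ 2).

End Matrices.

Definition conv_hull {R : realType} {d : nat} (A : set 'cV[R]_d) :
  set 'cV[R]_d := smallest (@convex_set R 'cV[R]_d) A.

Definition std_simplex (R : realType) (n : nat) : set 'rV[R]_n :=
  [set a | (forall i, 0 <= a 0 i) /\ \sum_i a 0 i = 1].

Section Ridgeline.
Context {R : realType} {n d : nat}.
Variables (X : 'I_n -> 'cV[R]_d) (Sigma : 'I_n -> 'M[R]_d).

(* [invmx] is the inverse on invertible matrices only; for positive definite
   [Sigma i] and [a] in the simplex, all matrices inverted here are
   invertible. *)
Definition ridge_point (a : 'rV[R]_n) : 'cV[R]_d :=
  invmx (\sum_i a 0 i *: invmx (Sigma i)) *m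
  (\sum_i a 0 i *: (invmx (Sigma i) *m X i)).

Definition ridgeline : set 'cV[R]_d :=
  [set ridge_point a | a in @std_simplex R n].

End Ridgeline.

(* R^d with its Borel sigma-algebra. *)
Definition borel_space (R : realType) (d : nat) :=
  g_sigma_algebraType (@open 'cV[R]_d).

Definition gauss_density {R : realType} {d : nat} (S : 'M[R]_d)
    (z : 'cV[R]_d) : R :=
  (Num.sqrt ((2 * pi) ^+ d * \det S))^-1 * expR (- qform (invmx S) z / 2).

(* The integrand is bounded and continuous when [S] is positive definite, so
   the real-valued integral is the genuine one. *)
Definition mixture_density {R : realType} {d : nat}
    (G : probability (borel_space R d) R) (S : 'M[R]_d) (x : 'cV[R]_d) : R :=
  \int[G]_theta gauss_density S (x - (theta : 'cV[R]_d)).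

(* For positive definite [Sigma i] every [mixture_density] is positive, so the
   convention on [ln] at nonpositive arguments plays no role. *)
Definition avg_loglik {R : realType} {n d : nat} (X : 'I_n -> 'cV[R]_d)
    (Sigma : 'I_n -> 'M[R]_d) (G : probability (borel_space R d) R) : R :=
  n%:R^-1 * \sum_i ln (mixture_density G (Sigma i) (X i)).

Definition is_npmle {R : realType} {n d : nat} (X : 'I_n -> 'cV[R]_d)
    (Sigma : 'I_n -> 'M[R]_d) (G : probability (borel_space R d) R) : Prop :=
  forall G' : probability (borel_space R d) R,
    avg_loglik X Sigma G' <= avg_loglik X Sigma G.

Definition msupport {R : realType} {d : nat}
    (G : probability (borel_space R d) R) : set 'cV[R]_d :=
  [set x | forall U : set 'cV[R]_d, open U -> U x -> (0 < G U)%E].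

(* Main.v *)
Require Import Defs.
From HB Require Import structures.
From mathcomp Require Import all_boot all_order all_algebra.
From mathcomp Require Import all_classical all_reals all_analysis.
From mathcomp Require Import measurable_realfun ring lra.
Import Order.TTheory GRing.Theory Num.Theory.
Import numFieldNormedType.Exports.
Local Open Scope classical_set_scope.
Local Open Scope ring_scope.

(* Support of a maximizer G: contaminating G by a Dirac mass at y cannot
   increase the likelihood, so the gradient function
   D(y) = sum_i phi_i(y) / f_i satisfies D <= n everywhere. Since its G-integral
   is n and D is continuous, D = n on the support. A support point thus
   maximizes D, hence is stationary, and stationarity is the ridge equation
   sum_i w_i Sigma_i^-1 (X_i - y) = 0 with weights w_i = phi_i(y) / f_i > 0.

   Parts 1-3 are all read off this equation: its solutions are the convex
   combinations of the X_i when the Sigma_i are proportional; it decouples into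
   coordinatewise weighted means when they are diagonal; and pairing it with
   y - x0 gives k_lo |y - x0| <= k_hi r by completing squares. *)

(** * Euclidean inner product on column vectors *)

Definition dot {R : realType} {d : nat} (u v : 'cV[R]_d) : R :=
  \sum_j u j 0 * v j 0.

Section Dot.
Context {R : realType} {d : nat}.
Implicit Types (u v w : 'cV[R]_d) (A : 'M[R]_d).

Lemma dotC u v : dot u v = dot v u.
Proof. by apply: eq_bigr => j _; rewrite mulrC. Qed.

Lemma dotDr u v w : dot u (v + w) = dot u v + dot u w.
Proof. by rewrite -big_split; apply: eq_bigr => j _; rewrite mxE mulrDr. Qed.

Lemma dotZr u t v : dot u (t *: v) = t * dot u v.
Proof. by rewrite mulr_sumr; apply: eq_bigr => j _; rewrite mxE mulrCA. Qed.

Lemma dotNr u v : dot u (- v) = - dot u v.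
Proof. by rewrite -scaleN1r dotZr mulN1r. Qed.

Lemma dotBr u v w : dot u (v - w) = dot u v - dot u w.
Proof. by rewrite dotDr dotNr. Qed.

Lemma dotBl u v w : dot (v - w) u = dot v u - dot w u.
Proof. by rewrite dotC dotBr !(dotC u). Qed.

Lemma dotZl u t v : dot (t *: v) u = t * dot v u.
Proof. by rewrite dotC dotZr dotC. Qed.

Lemma dot0r u : dot u 0 = 0.
Proof. by rewrite -(scale0r u) dotZr mul0r. Qed.

Lemma dot_sumr u n (F : 'I_n -> 'cV[R]_d) :
  dot u (\sum_i F i) = \sum_i dot u (F i).
Proof.
by rewrite exchange_big; apply: eq_bigr => j _; rewrite summxE mulr_sumr.
Qed.

Lemma dot_ge0 v : 0 <= dot v v.
Proof. by apply: sumr_ge0 => j _; rewrite -expr2 sqr_ge0. Qed.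

Lemma dot_eq0 v : (dot v v == 0) = (v == 0).
Proof.
apply/eqP/eqP => [/psumr_eq0P v0|->]; last by rewrite dot0r.
apply/colP => j; rewrite mxE; apply/eqP; rewrite -[_ == _]orbb -mulf_eq0.
by rewrite v0// => i _; rewrite -expr2 sqr_ge0.
Qed.

Lemma dot_mulmxr u A v : dot u (A *m v) = dot (A^T *m u) v.
Proof.
rewrite /dot; under eq_bigr do rewrite mxE mulr_sumr.
rewrite exchange_big; apply: eq_bigr => j _.
rewrite mxE mulr_suml; apply: eq_bigr => k _.
by rewrite mxE mulrA (mulrC (A k j)).
Qed.

Lemma dot_sym A u v : A^T = A -> dot u (A *m v) = dot v (A *m u).
Proof. by move=> Asym; rewrite dot_mulmxr Asym dotC. Qed.

Lemma qformE A v : qform A v = dot v (A *m v).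
Proof. by rewrite /qform -mulmxA mxE; apply: eq_bigr => j _; rewrite mxE. Qed.

Lemma enormE v : enorm v = Num.sqrt (dot v v).
Proof. by congr Num.sqrt; apply: eq_bigr => j _; rewrite expr2. Qed.

End Dot.

(** * Positive definite matrices *)

Section Posdef.
Context {R : realType} {d : nat}.
Implicit Types (A B S : 'M[R]_d) (v : 'cV[R]_d).

Lemma qform_ge0 {A} v : posdef A -> 0 <= qform A v.
Proof.
case=> _ Apos; have [->|/Apos/ltW//] := eqVneq v 0.
by rewrite qformE mulmx0 dot0r.
Qed.

(** A nonzero vector of the left kernel would annihilate the quadratic form. *)
Lemma posdef_unitmx A : posdef A -> A \in unitmx.
Proof.
case=> Asym Apos; rewrite unitmxE unitfE; apply/det0P => -[v v0 vA].
have vT0 : v^T != 0 by apply: contra_neq v0 => vT0; rewrite -[v]trmxK vT0 trmx0.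
by have := Apos _ vT0; rewrite /qform trmxK vA mul0mx mxE ltxx.
Qed.

(** Substituting [v = A *m w] turns the form of the inverse at [v] into the form of [A] at [w]. *)
Lemma posdef_invmx {A} : posdef A -> posdef (invmx A).
Proof.
move=> Apd; have Au := posdef_unitmx _ Apd; have [Asym Apos] := Apd.
split=> [|v v0]; first by rewrite trmx_inv Asym.
have := Apos (invmx A *m v); rewrite !qformE mulKVmx// dotC; apply.
by apply: contra_neq v0 => Av0; rewrite -[v](mulKVmx Au) Av0 mulmx0.
Qed.

Lemma posdef_sum n (w : 'I_n -> R) (P : 'I_n -> 'M[R]_d) :
  (forall i, 0 <= w i) -> 0 < \sum_i w i -> (forall i, posdef (P i)) ->
  posdef (\sum_i w i *: P i).
Proof.
move=> w0 sw Ppd; split=> [|v v0].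
  by rewrite linear_sum; apply: eq_bigr => i _; rewrite linearZ /= (Ppd i).1.
have -> : qform (\sum_i w i *: P i) v = \sum_i w i * qform (P i) v.
  rewrite qformE mulmx_suml dot_sumr; apply: eq_bigr => i _.
  by rewrite -scalemxAl dotZr qformE.
have Pv i : 0 < qform (P i) v := (Ppd i).2 _ v0.
have term0 i : true -> 0 <= w i * qform (P i) v.
  by move=> _; rewrite mulr_ge0// ltW.
(* If the form vanished at [v], every term and hence every weight would vanish, against [sw]. *)
rewrite lt_neqAle sumr_ge0// andbT eq_sym; apply: contraL sw => /eqP s0.
rewrite big1 ?ltxx// => i _; apply/eqP.
have /eqP : w i * qform (P i) v = 0 := psumr_eq0P term0 s0 isT.
by rewrite mulf_eq0 [X in _ || X]gt_eqF ?orbF.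
Qed.

(* On the segment from [A] to the identity the determinant never vanishes. *)
Lemma posdef_det_gt0 {A} : posdef A -> 0 < \det A.
Proof.
move=> Apd.
(* As a polynomial in the segment parameter, the determinant is subject to the intermediate value
   theorem; it is [\det A] at 0 and 1 at 1. *)
pose p := \det ('X%:M + (1 - 'X) *: map_mx polyC A).
have pE t : p.[t] = \det (t%:M + (1 - t) *: A).
  rewrite /p -horner_evalE -det_map_mx; congr (\det _).
  apply/matrixP => i j; rewrite !mxE/= horner_evalE !hornerE.
  by rewrite hornerMn hornerX.
have p_neq0 t : 0 <= t <= 1 -> p.[t] != 0.
  move=> /andP[t0 t1]; rewrite pE -unitfE -unitmxE posdef_unitmx//.
  split=> [|v v0].
    by rewrite linearD linearZ /= tr_scalar_mx Apd.1.
  rewrite qformE mulmxDl mul_scalar_mx dotDr dotZr -scalemxAl dotZr -qformE.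
  have v2 : 0 < dot v v by rewrite lt_neqAle dot_ge0 eq_sym dot_eq0 v0.
  have := Apd.2 _ v0; nra.
have p0 : p.[0] = \det A by rewrite pE subr0 scale1r raddf0 add0r.
have p1 : p.[1] = 1 by rewrite pE subrr scale0r addr0 det1.
rewrite -p0 lt_neqAle eq_sym p_neq0 ?lexx ?ler01//= leNgt; apply/negP => p_lt0.
have [||x x01 /rootP xp] := @poly_ivt R p 0 1; rewrite ?ler01//.
  by rewrite p1 ler01 ltW.
by have := p_neq0 _ x01; rewrite xp eqxx.
Qed.

End Posdef.

(** * Renormalizing weights into the simplex *)

Section Simplex.
Context {R : realType} {n : nat}.

Lemma std_simplex_normalize (w : 'I_n -> R) :
  (forall i, 0 <= w i) -> 0 < \sum_i w i ->
  @std_simplex R n (\row_i (w i / \sum_k w k)).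
Proof.
move=> w0 sw; split=> [i|]; first by rewrite mxE divr_ge0// ltW.
by under eq_bigr do rewrite mxE; rewrite -mulr_suml divff// gt_eqF.
Qed.

Lemma std_simplex_sum_gt0 {a : 'rV[R]_n} (c : 'I_n -> R) :
  std_simplex a -> (forall i, 0 < c i) -> 0 < \sum_i a 0 i * c i.
Proof.
move=> [a0 a1] c0; have ac0 i : true -> 0 <= a 0 i * c i.
  by move=> _; rewrite mulr_ge0// ltW.
rewrite lt_neqAle sumr_ge0// andbT eq_sym.
apply: contra_eqN a1 => /eqP s0.
rewrite big1 1?eq_sym ?oner_eq0// => i _; apply/eqP.
have /eqP : a 0 i * c i = 0 := psumr_eq0P ac0 s0 isT.
by rewrite mulf_eq0 [X in _ || X]gt_eqF ?orbF.
Qed.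

End Simplex.

(** * The ridge equation *)

Section Ridge.
Context {R : realType} {n d : nat}.
Variables (X : 'I_n -> 'cV[R]_d) (Sigma : 'I_n -> 'M[R]_d).
Hypothesis Sigma_posdef : forall i, posdef (Sigma i).

(** The matrix [W] is positive definite, hence invertible, so the closed formula amounts to a linear
    equation in [y]. *)
Lemma ridge_pointP (a : 'rV[R]_n) y : std_simplex a ->
  ridge_point X Sigma a = y <->
  \sum_i a 0 i *: (invmx (Sigma i) *m (X i - y)) = 0.
Proof.
move=> [a0 a1]; set W := \sum_i a 0 i *: invmx (Sigma i).
have Wu : W \in unitmx.
  apply: posdef_unitmx; apply: posdef_sum; rewrite ?a1//.
  by move=> i; exact: posdef_invmx.
have -> : \sum_i a 0 i *: (invmx (Sigma i) *m (X i - y)) =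
    \sum_i a 0 i *: (invmx (Sigma i) *m X i) - W *m y.
  rewrite mulmx_suml -sumrB; apply: eq_bigr => i _.
  by rewrite mulmxBr scalerBr -scalemxAl.
rewrite /ridge_point -/W; split=> [<-|/eqP].
  by rewrite mulKVmx// subrr.
by rewrite subr_eq0 => /eqP ->; rewrite mulKmx.
Qed.

(** The ridge equation is homogeneous in the weights, so they may be divided by their total. *)
Lemma ridgeline_weights (w : 'I_n -> R) y :
  (forall i, 0 <= w i) -> 0 < \sum_i w i ->
  \sum_i w i *: (invmx (Sigma i) *m (X i - y)) = 0 -> ridgeline X Sigma y.
Proof.
move=> w0 sw wy; have aS := std_simplex_normalize w w0 sw.
exists (\row_i (w i / \sum_k w k)) => //; apply/(ridge_pointP _ _ aS).
under eq_bigr do rewrite mxE mulrC -scalerA.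
by rewrite -scaler_sumr wy scaler0.
Qed.

End Ridge.

(** * Convex hull of a finite family *)

Section ConvexHull.
Context {R : realType} {d : nat}.
Implicit Types C : set 'cV[R]_d.

(** Induction from binary to finite combinations; dividing by the total weight keeps the statement
    meaningful for the tail, whose weights need not sum to one. *)
Lemma convex_combination_mem {C} {I : eqType} (x : I -> 'cV[R]_d) (w : I -> R)
    (s : seq I) :
  @convex_set R 'cV[R]_d C -> (forall i, C (x i)) -> (forall i, 0 <= w i) ->
  0 < \sum_(i <- s) w i ->
  C ((\sum_(i <- s) w i)^-1 *: \sum_(i <- s) w i *: x i).
Proof.
move=> Cconv Cx w0; elim: s => [|i s IHs]; first by rewrite big_nil ltxx.
rewrite !big_cons; set W := \sum_(j <- s) w j => sw.
have W0 : 0 <= W by apply: sumr_ge0.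
(* A tail of total weight zero contributes nothing, and only the head point is left. *)
have [Weq0|Wneq0] := eqVneq W 0.
  have -> : \sum_(j <- s) w j *: x j = 0.
    rewrite big_seq big1// => j js; move/eqP: Weq0.
    rewrite psumr_eq0// => /allP/(_ j js)/= /eqP ->; exact: scale0r.
  rewrite Weq0 !addr0 in sw *.
  by rewrite scalerA mulVf ?gt_eqF// scale1r.
have Wgt0 : 0 < W by rewrite lt_neqAle eq_sym Wneq0.
(* The head gets its share of the total weight; the normalized tail gets the rest. *)
have t01 : 0 <= w i / (w i + W) <= 1.
  by rewrite divr_ge0 ?(ltW sw)//= ler_pdivrMr// mul1r lerDl.
have [t0 t1] := andP t01.
pose t : {i01 R} := Itv01 t0 t1.
have := Cconv (x i) (W^-1 *: \sum_(j <- s) w j *: x j) t.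
rewrite !inE => /(_ (Cx i) (IHs Wgt0)).
congr C; rewrite /conv/= /unstable.onem scalerDr scalerA mulrC; congr (_ + _).
  by rewrite scalerA.
congr (_ *: _); field.
by rewrite Wneq0 gt_eqF.
Qed.

(** The right-hand side is convex and contains each [X i], at the simplex vertex [delta_mx 0 i];
    conversely, any convex set containing the points contains their combinations. *)
Lemma conv_hull_range {n : nat} (X : 'I_n -> 'cV[R]_d) :
  conv_hull [set X i | i in [set: 'I_n]] =
  [set \sum_i b 0 i *: X i | b in @std_simplex R n].
Proof.
apply/seteqP; split.
  apply: smallest_sub => [x y t|_ [i _ <-]].
    rewrite !inE => -[a [a0 a1] <-] [b [b0 b1] <-].
    have t0 : 0 <= t%:num by [].
    have t1 : 0 <= 1 - t%:num by rewrite subr_ge0.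
    exists (t%:num *: a + (1 - t%:num) *: b).
      split=> [i|]; first by rewrite !mxE addr_ge0// mulr_ge0.
      under eq_bigr do rewrite !mxE.
      by rewrite big_split/= -!mulr_sumr a1 b1; ring.
    rewrite /conv/= /unstable.onem !scaler_sumr -big_split; apply: eq_bigr => i _.
    by rewrite !mxE scalerDl !scalerA.
  exists (delta_mx 0 i).
    split=> [j|]; first by rewrite mxE ler0n.
    rewrite (bigD1 i)//= big1 ?mxE ?eqxx ?addr0// => j /negPf ji.
    by rewrite mxE ji andbF.
  rewrite (bigD1 i)//= big1 ?mxE ?eqxx ?scale1r ?addr0// => j /negPf ji.
  by rewrite mxE ji andbF scale0r.
move=> _ [b [b0 b1] <-] C [Cconv CX].
have := @convex_combination_mem C _ X (b 0) (index_enum 'I_n) Cconv.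
rewrite b1 invr1 scale1r; apply=> //.
by move=> i; apply: CX; exists i.
Qed.

End ConvexHull.

(** * Locating the ridgeline for proportional, diagonal and bounded covariances *)

Section Inclusions.
Context {R : realType} {n d : nat}.
Variables (X : 'I_n -> 'cV[R]_d) (Sigma : 'I_n -> 'M[R]_d).
Hypothesis Sigma_posdef : forall i, posdef (Sigma i).

(** The common invertible factor [invmx S] drops out of the ridge equation: ridge weights [a i]
    correspond to convex weights proportional to [a i / c i], and convex weights [b i] to ridge
    weights proportional to [b i * c i]. *)
Lemma ridgeline_proportional (c : 'I_n -> R) (S : 'M[R]_d) :
  (forall i, 0 < c i) -> posdef S -> (forall i, Sigma i = c i *: S) ->
  ridgeline X Sigma = conv_hull [set X i | i in [set: 'I_n]].
Proof.
move=> c0 Spd SigmaE; have Su := posdef_unitmx _ Spd.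
have ciV i : 0 < (c i)^-1 by rewrite invr_gt0.
have invSigma i v : invmx (Sigma i) *m v = invmx S *m ((c i)^-1 *: v).
  rewrite SigmaE invmxZ ?unitfE ?gt_eqF// -?scalemxAl ?scalemxAr//.
  by rewrite unitmxZ// unitfE gt_eqF.
rewrite conv_hull_range; apply/seteqP; split=> [y [a aS ay]|_ [b [b0 b1] <-]].
  have sw := std_simplex_sum_gt0 _ aS ciV.
  exists (\row_i (a 0 i / c i / \sum_k a 0 k / c k)).
    apply: (std_simplex_normalize (fun i => a 0 i / c i)) => // i.
    by rewrite divr_ge0 ?aS.1// ltW.
  have /(ridge_pointP _ _ Sigma_posdef _ _ aS) := ay.
  under eq_bigr do rewrite invSigma scalemxAr scalerA scalerBr.
  rewrite -mulmx_sumr => /(congr1 (mulmx S)); rewrite mulKVmx// mulmx0.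
  rewrite sumrB -scaler_suml => /eqP; rewrite subr_eq0 => /eqP swE.
  under eq_bigr do rewrite mxE mulrC -scalerA.
  by rewrite -scaler_sumr swE scalerA mulVf ?gt_eqF// scale1r.
have bS : std_simplex b by [].
apply: (ridgeline_weights _ _ Sigma_posdef (fun i => b 0 i * c i)).
- by move=> i; rewrite mulr_ge0 ?b0 ?ltW.
- exact: std_simplex_sum_gt0.
under eq_bigr => i _.
  rewrite invSigma scalemxAr scalerA mulfK ?gt_eqF// scalerBr; over.
by rewrite -mulmx_sumr sumrB -scaler_suml b1 scale1r subrr mulmx0.
Qed.

(** Right multiplication by a diagonal matrix scales columns, so [invmx A *m A = 1] can be solved
    entry by entry. *)
Lemma invmx_diag_entry {A : 'M[R]_d} (i j : 'I_d) :
  A \in unitmx -> is_diag_mx A -> i != j -> invmx A i j = 0.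
Proof.
move=> Au /is_diag_mxP Adiag ij.
have AVE k l : (invmx A *m A) k l = invmx A k l * A l l.
  rewrite mxE (bigD1 l)//= big1 ?addr0// => m ml.
  by rewrite Adiag ?mulr0.
have Ajj : A j j != 0.
  have := AVE j j; rewrite mulVmx// mxE eqxx => A1.
  by apply/eqP => Ajj0; move/eqP: A1; rewrite Ajj0 mulr0 oner_eq0.
have := AVE i j; rewrite mulVmx// mxE (negPf ij) => /esym/eqP.
by rewrite mulf_eq0 (negPf Ajj) orbF => /eqP.
Qed.

Lemma posdef_diag_gt0 {A : 'M[R]_d} j : posdef A -> 0 < A j j.
Proof.
move=> [_ /(_ (delta_mx j 0))].
rewrite /qform trmx_delta -rowE -colE !mxE; apply.
by apply/eqP => /matrixP/(_ j 0); rewrite !mxE !eqxx => /eqP; rewrite oner_eq0.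
Qed.

(** Inverses of diagonal matrices do not mix coordinates, so the ridge equation makes coordinate [j]
    a weighted mean of the [X i j 0]. *)
Lemma ridgeline_diag_coord a j : std_simplex a ->
  (forall i, is_diag_mx (Sigma i)) ->
  \sum_i (a 0 i * invmx (Sigma i) j j) * (X i j 0 - ridge_point X Sigma a j 0)
    = 0.
Proof.
move=> aS Sdiag.
have [y yE] : exists y, ridge_point X Sigma a = y by eexists.
rewrite yE; move/(ridge_pointP X Sigma Sigma_posdef a y aS)/colP/(_ j): yE.
rewrite [RHS]mxE summxE => s0; rewrite -[RHS]s0.
apply: eq_bigr => i _.
rewrite !mxE (bigD1 j)//= big1 ?addr0 ?mxE ?mulrA// => k kj.
by rewrite invmx_diag_entry ?mul0r 1?eq_sym//; exact: posdef_unitmx.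
Qed.

Lemma ridgeline_diag_le a j M : std_simplex a ->
  (forall i, is_diag_mx (Sigma i)) -> (forall i, X i j 0 <= M) ->
  ridge_point X Sigma a j 0 <= M.
Proof.
move=> aS Sdiag XM; set y := ridge_point X Sigma a.
have w0 i : 0 < invmx (Sigma i) j j := posdef_diag_gt0 j (posdef_invmx (Sigma_posdef i)).
have sw := std_simplex_sum_gt0 _ aS w0.
rewrite -(ler_pM2l sw) -subr_ge0 -mulrBr mulr_suml.
rewrite -[leLHS](ridgeline_diag_coord a j aS Sdiag); apply: ler_sum => i _.
by rewrite ler_wpM2l ?lerB// mulr_ge0 ?aS.1// ltW.
Qed.

Lemma ridgeline_diag_ge a j m : std_simplex a ->
  (forall i, is_diag_mx (Sigma i)) -> (forall i, m <= X i j 0) ->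
  m <= ridge_point X Sigma a j 0.
Proof.
move=> aS Sdiag Xm; set y := ridge_point X Sigma a.
have w0 i : 0 < invmx (Sigma i) j j := posdef_diag_gt0 j (posdef_invmx (Sigma_posdef i)).
have sw := std_simplex_sum_gt0 _ aS w0.
rewrite -(ler_pM2l sw) -subr_le0 -mulrBr mulr_suml.
rewrite -[leRHS](ridgeline_diag_coord a j aS Sdiag); apply: ler_sum => i _.
by rewrite ler_wpM2l ?lerB// mulr_ge0 ?aS.1// ltW.
Qed.

(** Expansion of the squared length of [v - e *: u]. *)
Lemma dot_young (e : R) (u v : 'cV[R]_d) :
  e * dot u v *+ 2 <= e ^+ 2 * dot u u + dot v v.
Proof.
have := dot_ge0 (v - e *: u).
rewrite dotBr !dotBl !dotZr !dotZl (dotC v u); lra.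
Qed.

(** With [w = invmx A *m u], the lower bound on [A] gives [k * dot w w <= dot w u], and [dot_young]
    absorbs the cross term. *)
Lemma dot_invmx_le (k : R) (A : 'M[R]_d) u : 0 < k -> posdef A ->
  loewner_le k%:M A ->
  k ^+ 2 * dot (invmx A *m u) (invmx A *m u) <= dot u u.
Proof.
move=> k0 Apd [_ /(_ (invmx A *m u))].
rewrite qformE mulmxBl mul_scalar_mx mulKVmx ?posdef_unitmx//.
rewrite dotBr dotZr; set w := invmx A *m u => kw.
have := dot_young k w u; nra.
Qed.

(* Expand [0 <= (w - u / k)^T A (w - u / k)] at [w = invmx A *m u]. *)
Lemma qform_invmx_ge (k : R) (A : 'M[R]_d) u : 0 < k -> posdef A ->
  loewner_le A k%:M -> dot u u <= k * dot u (invmx A *m u).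
Proof.
move=> k0 Apd [_ /(_ u)]; rewrite qformE mulmxBl mul_scalar_mx dotBr dotZr => Ak.
set w := invmx A *m u.
have Aw : A *m w = u by rewrite mulKVmx ?posdef_unitmx.
have := qform_ge0 (k *: w - u) Apd.
rewrite qformE mulmxBr -scalemxAr Aw !dotBr !dotBl !dotZr !dotZl.
rewrite (dot_sym _ _ _ Apd.1) Aw (dotC w u); nra.
Qed.

Lemma ridgeline_ball (k_lo k_hi r : R) x0 a : 0 < k_lo -> k_lo <= k_hi ->
  (forall i, loewner_le k_lo%:M (Sigma i) /\ loewner_le (Sigma i) k_hi%:M) ->
  0 < r -> (forall i, enorm (X i - x0) <= r) -> std_simplex a ->
  enorm (ridge_point X Sigma a - x0) <= k_hi / k_lo * r.
Proof.
move=> lo0 lohi Sk r0 Xr aS; set y := ridge_point X Sigma a; set z := y - x0.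
have hi0 : 0 < k_hi := lt_le_trans lo0 lohi.
pose zz := dot z z; rewrite enormE.
pose w i := invmx (Sigma i) *m (X i - x0).
have wr i : k_lo ^+ 2 * dot (w i) (w i) <= r ^+ 2.
  apply: le_trans (dot_invmx_le _ _ _ lo0 (Sigma_posdef i) (Sk i).1) _.
  rewrite -(sqr_sqrtr (dot_ge0 _)) -enormE ler_pXn2r ?nnegrE//; last exact: ltW.
  exact: sqrtr_ge0.
(* The factor [2 * k_lo ^+ 2] clears denominators: [dot_young] bounds the pairing of [z] with [w i],
   [wr] bounds [w i], and [qform_invmx_ge] bounds the quadratic term in [z] from below. *)
have key i : k_hi * dot z (invmx (Sigma i) *m (X i - y)) * (2 * k_lo ^+ 2)
    <= k_hi ^+ 2 * r ^+ 2 - k_lo ^+ 2 * zz.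
  have -> : X i - y = (X i - x0) - z by rewrite /z opprB addrA subrK.
  rewrite mulmxBr dotBr -/(w i).
  have zPz := qform_invmx_ge _ _ z hi0 (Sigma_posdef i) (Sk i).2.
  have yg := dot_young k_hi (w i) z; rewrite dotC in yg.
  have := wr i; rewrite -/zz in zPz yg *; nra.
(* Averaging [key] with the weights [a 0 i], of total one, makes the left side vanish by the ridge
   equation. *)
have zzle : k_lo ^+ 2 * zz <= k_hi ^+ 2 * r ^+ 2.
  have /(ridge_pointP _ _ Sigma_posdef _ y aS) /(congr1 (dot z)) := erefl y.
  rewrite dot0r dot_sumr => s0; rewrite -subr_ge0 -[leRHS]mul1r -aS.2.
  rewrite mulr_suml.
  have sum0 : \sum_i a 0 i *
      (k_hi * dot z (invmx (Sigma i) *m (X i - y)) * (2 * k_lo ^+ 2)) = 0.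
    rewrite -[RHS](mulr0 (k_hi * (2 * k_lo ^+ 2))) -[in RHS]s0 mulr_sumr.
    by apply: eq_bigr => i _; rewrite dotZr; ring.
  rewrite -[leLHS]sum0.
  by apply: ler_sum => i _; rewrite ler_wpM2l ?aS.1.
rewrite -(@ler_pXn2r _ 2) ?nnegrE ?sqrtr_ge0 ?sqr_sqrtr ?dot_ge0//; last first.
  by rewrite mulr_ge0 ?divr_ge0 ?ltW.
rewrite mulrAC expr_div_n ler_pdivlMr ?exprn_gt0//.
by rewrite exprMn mulrC.
Qed.

End Inclusions.

(** * Gaussian densities: bounds and continuity *)

Lemma continuous_sumr {R : realType} {T : topologicalType} n (F : 'I_n -> T -> R) :
  (forall i, continuous (F i)) -> continuous (fun x => \sum_i F i x).
Proof.
move=> Fcont x; apply: cvg_big => [|i _]; first exact: add_continuous.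
exact: Fcont.
Qed.

Section GaussDensity.
Context {R : realType} {d : nat}.
Variable S : 'M[R]_d.
Hypothesis S_posdef : posdef S.

Lemma gauss_normalization_gt0 : 0 < (Num.sqrt ((2 * pi) ^+ d * \det S))^-1.
Proof.
by rewrite invr_gt0 sqrtr_gt0 mulr_gt0 ?posdef_det_gt0// exprn_gt0// mulr_gt0// pi_gt0.
Qed.

Lemma gauss_density_gt0 z : 0 < gauss_density S z.
Proof. by rewrite mulr_gt0 ?expR_gt0// gauss_normalization_gt0. Qed.

Lemma gauss_density_le z :
  gauss_density S z <= (Num.sqrt ((2 * pi) ^+ d * \det S))^-1.
Proof.
rewrite ler_piMr ?(ltW gauss_normalization_gt0)// expR_le1 mulNr oppr_le0.
by rewrite divr_ge0// qform_ge0//; exact: posdef_invmx.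
Qed.

Lemma continuous_gauss_density x :
  continuous (fun y : 'cV[R]_d => gauss_density S (x - y)).
Proof.
have qcont : continuous (fun y : 'cV[R]_d => qform (invmx S) (x - y)).
  have -> : (fun y : 'cV[R]_d => qform (invmx S) (x - y)) =
      fun y => \sum_j \sum_k
        (x j 0 - y j 0) * (invmx S j k * (x k 0 - y k 0)).
    apply/funext => y; rewrite qformE; apply: eq_bigr => j _.
    rewrite !mxE mulr_sumr; apply: eq_bigr => k _.
    by rewrite !mxE.
  have ccont j : continuous (fun y : 'cV[R]_d => x j 0 - y j 0).
    move=> y; apply: continuousB; first exact: cst_continuous.
    exact: coord_continuous.
  apply: continuous_sumr => j; apply: continuous_sumr => k y.
  apply: (@continuousM R 'cV[R]_d (fun y => x j 0 - y j 0)); first exact: ccont.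
  by apply: continuousM; [exact: cst_continuous|exact: ccont].
move=> y; apply: (@continuousM R 'cV[R]_d (fun=> _)
  (fun y => expR (- qform (invmx S) (x - y) / 2))); first exact: cst_continuous.
apply: (@continuous_comp 'cV[R]_d R R (fun y => - qform (invmx S) (x - y) / 2) (@expR R)).
  apply: (@continuousM R 'cV[R]_d (fun y => - qform (invmx S) (x - y))).
    by apply: continuousN; exact: qcont.
  exact: cst_continuous.
exact: continuous_expR.
Qed.

(** The inequality [1 + s <= expR s], applied to the change of exponent along the line, gives a
    lower bound with the exact first-order term, which stands in for a derivative. *)
Lemma gauss_density_line_ge x y v t :
  gauss_density S (x - y) * (1 + t * dot v (invmx S *m (x - y))
    - t ^+ 2 * (dot v (invmx S *m v) / 2))
  <= gauss_density S (x - (y + t *: v)).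
Proof.
have -> : x - (y + t *: v) = (x - y) - t *: v by rewrite opprD addrA.
rewrite /gauss_density -mulrA ler_wpM2l ?(ltW gauss_normalization_gt0)//.
set P := invmx S; move: (x - y) => u.
have Psym : P^T = P by have [] := posdef_invmx S_posdef.
have -> : - qform P (u - t *: v) / 2 = - qform P u / 2 +
    (t * dot v (P *m u) - t ^+ 2 * (dot v (P *m v) / 2)).
  rewrite !qformE mulmxBr -scalemxAr !dotBr !dotBl !dotZr !dotZl.
  by rewrite (dot_sym _ u v Psym); field.
by rewrite expRD ler_wpM2l ?expR_ge0// -addrA expR_ge1Dx.
Qed.

End GaussDensity.

(** * Continuous functions under Borel probabilities *)

Section BorelSpace.
Context {R : realType} {d : nat}.
Implicit Types (f : 'cV[R]_d -> R) (G : probability (borel_space R d) R).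

Lemma continuous_measurable_borel f :
  continuous f -> measurable_fun setT (f : borel_space R d -> R).
Proof.
move=> /continuousP fcont.
apply: (measurability _ (RGenOpens.measurableE R)) => _ [_ [a [b ->]] <-].
rewrite setTI; apply: sub_sigma_algebra; apply: fcont.
exact: interval_open.
Qed.

Lemma continuous_bounded_integrable G f M :
  continuous f -> (forall x, `|f x| <= M) ->
  G.-integrable setT (EFin \o (f : borel_space R d -> R)).
Proof.
move=> fcont fM; apply: measurable_bounded_integrable => //.
- exact: le_lt_trans (probability_le1 G measurableT) (ltry 1).
- exact: continuous_measurable_borel.
exists M; split; first exact: num_real.
by move=> x Mx y _; apply: le_trans (fM y) (ltW Mx).
Qed.

(** The open set [U] where [f] exceeds [f x / 2] has positive mass, so the integral is at least
    [f x / 2] times that mass. *)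
Lemma Rintegral_support_gt0 G f M x :
  continuous f -> (forall y, 0 <= f y <= M) -> msupport G x -> 0 < f x ->
  0 < \int[G]_y (f (y : 'cV[R]_d)).
Proof.
move=> fcont f0M Gx fx.
pose U := f @^-1` `]f x / 2, +oo[%classic.
have Uo : open U by move/continuousP : fcont; apply; exact: interval_open.
have Ux : U x by rewrite /U/= in_itv/= andbT; lra.
have GU : (0 < G U)%E := Gx _ Uo Ux.
have mU : measurable (U : set (borel_space R d)) by exact: sub_sigma_algebra.
have fint : G.-integrable setT (EFin \o (f : borel_space R d -> R)).
  apply: (continuous_bounded_integrable _ _ M) => // y.
  by have /andP[f0 fM] := f0M y; rewrite ger0_norm.
have GUfin : G U \is a fin_num by exact: fin_num_measure.
rewrite -lte_fin fineK; last exact: integrable_fin_num.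
apply: (@lt_le_trans _ _ (\int[G]_(y in U) (f x / 2)%:E)%E).
  by rewrite integral_cst// mule_gt0// lte_fin divr_gt0.
apply: (@le_trans _ _ (\int[G]_(y in U) (f y)%:E)%E).
  apply: ge0_le_integral => //=.
  - by move=> y _; rewrite lee_fin divr_ge0// ltW.
  - by apply/measurable_EFinP/measurable_funTS; exact: continuous_measurable_borel.
  - by move=> y; rewrite /U/= in_itv/= andbT lee_fin => /ltW.
apply: ge0_subset_integral => //=.
  by apply/measurable_EFinP; exact: continuous_measurable_borel.
by move=> y _; rewrite lee_fin; have /andP[] := f0M y.
Qed.

End BorelSpace.

(** * First-order optimality from elementary inequalities *)

(** Dividing by [t] and letting [t] tend to 0 leaves [b <= 0]; a single small [t] suffices. *)
Lemma linear_le_quadratic_le0 {R : realFieldType} (b c : R) :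
  (forall t, 0 < t -> t <= 1 / 2 -> t * b <= t ^+ 2 * c) -> b <= 0.
Proof.
move=> bc; rewrite leNgt; apply/negP => b0.
have c1 : 0 < 2 * (`|c| + 1) by rewrite mulr_gt0// ltr_wpDl.
(* This choice makes [t * c] smaller than a positive [b]; adding 1 to [|c|] keeps the denominator
   nonzero. *)
pose t := Num.min (1 / 2) (b / (2 * (`|c| + 1))).
have t0 : 0 < t by rewrite lt_min !divr_gt0.
have t2 : t <= 1 / 2 by rewrite ge_min lexx.
have tb : t * (2 * (`|c| + 1)) <= b by rewrite -ler_pdivlMr// ge_min lexx orbT.
have := bc t t0 t2; rewrite expr2 -mulrA ler_pM2l// => btc.
have := ler_norm c; nra.
Qed.

(** This is [1 + s <= expR s] at [s = - ln y]. *)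
Lemma ln_ge1BV {R : realType} (y : R) : 0 < y -> 1 - y^-1 <= ln y.
Proof.
move=> y0; have := expR_ge1Dx (- ln y).
by rewrite expRN lnK ?posrE//; lra.
Qed.

(* First-order optimality of the concave function [sum_i ln]: the one-sided
   derivative in the direction [p - f] at [f] is nonpositive. *)
Lemma sum_ln_first_order {R : realType} n (f p : 'I_n -> R) :
  (forall i, 0 < f i) -> (forall i, 0 < p i) ->
  (forall t, 0 < t -> t <= 1 / 2 ->
    \sum_i ln ((1 - t) * f i + t * p i) <= \sum_i ln (f i)) ->
  \sum_i p i / f i <= n%:R.
Proof.
move=> f0 p0 max_f.
have -> : (n%:R : R) = \sum_(i < n) 1 by rewrite sumr_const card_ord.
rewrite -subr_le0 -sumrB.
(* With [s = t * (p i / f i - 1)], one has [ln (1 + s) >= s / (1 + s) >= s - 2 * s ^+ 2]; the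
   constant 2 comes from [1 + s >= 1 / 2], which holds since [t <= 1 / 2]. *)
apply: (linear_le_quadratic_le0 _ (\sum_i 2 * (p i / f i - 1) ^+ 2)) => t t0 t2.
rewrite -subr_le0 !mulr_sumr -sumrB.
apply: le_trans (_ : \sum_i (ln ((1 - t) * f i + t * p i) - ln (f i)) <= 0);
  last by rewrite sumrB subr_le0 max_f.
apply: ler_sum => i _; set a := p i / f i.
have a0 : 0 < a by rewrite divr_gt0.
have pE : p i = a * f i by rewrite divfK// gt_eqF.
have -> : (1 - t) * f i + t * p i = (1 + t * (a - 1)) * f i by rewrite pE; ring.
have half : 1 / 2 <= 1 + t * (a - 1) by nra.
have y0 : 0 < 1 + t * (a - 1) by apply: lt_le_trans half; lra.
rewrite lnM ?posrE// addrK; apply: le_trans (ln_ge1BV _ y0).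
rewrite -(ler_pM2r y0) [leRHS]mulrBl mul1r mulVf ?gt_eqF//.
have : 0 <= (t * (a - 1)) ^+ 2 by rewrite sqr_ge0.
nra.
Qed.

(** * Integrals of finite sums *)

Section Rintegral.
Context {d : measure_display} {T : measurableType d} {R : realType}.
Variable mu : {measure set T -> \bar R}.

(** Both conclusions share one induction, since additivity at each step needs integrability of the
    tail. *)
Lemma Rintegral_sum {I : Type} (s : seq I) (F : I -> T -> R) :
  (forall i, mu.-integrable setT (EFin \o F i)) ->
  mu.-integrable setT (EFin \o (fun x => \sum_(i <- s) F i x)) /\
  \int[mu]_x (\sum_(i <- s) F i x) = \sum_(i <- s) \int[mu]_x F i x.
Proof.
move=> Fint; elim: s => [|i s [IHint IHs]].
  have -> : (fun x => \sum_(i <- [::]) F i x) = cst 0.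
    by apply/funext => x; rewrite big_nil.
  split; first exact: integrable0.
  by rewrite big_nil Rintegral_cst// mul0r.
have -> : (fun x => \sum_(j <- i :: s) F j x) =
    (fun x => F i x + \sum_(j <- s) F j x).
  by apply/funext => x; rewrite big_cons.
split; first exact: (integrableD measurableT (Fint i) IHint).
by rewrite RintegralD// IHs big_cons.
Qed.

End Rintegral.

(** * Mixing a probability with a Dirac mass *)

Section Contamination.
Context {d : measure_display} {T : measurableType d} {R : realType}.
Variables (G : probability T R) (x : T) (t : R) (t0 : 0 <= t) (t1 : 0 <= 1 - t).

Definition contaminate : set T -> \bar R :=
  measure_add (mscale (NngNum t1) G) (mscale (NngNum t0) (\d_x)).

HB.instance Definition _ := Measure.on contaminate.

Lemma contaminate_setT : contaminate setT = 1%E.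
Proof.
rewrite /contaminate measure_addE.
change ((1 - t)%:E * G setT + t%:E * \d_x setT = 1)%E.
rewrite probability_setT diracT !mule1.
by rewrite -EFinD subrK.
Qed.

HB.instance Definition _ :=
  Measure_isProbability.Build _ _ _ contaminate contaminate_setT.

(** Nonnegativity splits the integral over the two measures; integrability makes both pieces finite,
    so [fine] respects the sum. *)
Lemma Rintegral_contaminate (f : T -> R) :
  (forall y, 0 <= f y) -> G.-integrable setT (EFin \o f) ->
  \int[contaminate]_y f y = (1 - t) * \int[G]_y f y + t * f x.
Proof.
move=> f0 fint; have fmeas := measurable_int _ fint.
have fE0 y : setT y -> (0 <= (EFin \o f) y)%E by rewrite lee_fin.
rewrite /Rintegral ge0_integral_measure_add// !ge0_integral_mscale//=.
rewrite integral_dirac// diracT mul1e -EFinM.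
have Gfin := integrable_fin_num measurableT fint.
by rewrite fineD ?fineM ?fin_numM//=.
Qed.

End Contamination.

(** * Support of a likelihood maximizer *)

Section Npmle.
Context {R : realType} {n d : nat}.
Variables (X : 'I_n -> 'cV[R]_d) (Sigma : 'I_n -> 'M[R]_d).
Hypothesis Sigma_posdef : forall i, posdef (Sigma i).
Hypothesis n_gt0 : (0 < n)%N.
Variable G : probability (borel_space R d) R.
Hypothesis G_npmle : is_npmle X Sigma G.

Let phi i (y : 'cV[R]_d) := gauss_density (Sigma i) (X i - y).
Let f i := mixture_density G (Sigma i) (X i).

Let phi_gt0 i y : 0 < phi i y.
Proof. exact: gauss_density_gt0. Qed.

Let phi_continuous i : continuous (phi i).
Proof. exact: continuous_gauss_density. Qed.

Let phi_integrable i (H : probability (borel_space R d) R) :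
  H.-integrable setT (EFin \o (phi i : borel_space R d -> R)).
Proof.
apply: continuous_bounded_integrable => [//|y].
by rewrite ger0_norm ?(ltW (phi_gt0 i y))//; exact: gauss_density_le.
Qed.

Let f_gt0 x i : msupport G x -> 0 < f i.
Proof.
move=> Gx; apply: (@Rintegral_support_gt0 _ _ G (phi i) _ x) => // y.
by rewrite (ltW (phi_gt0 i y)); exact: gauss_density_le.
Qed.

(** The competitor is [G] contaminated at [y], whose mixture densities are
    [(1 - t) * f i + t * phi i y]. *)
Lemma npmle_gradient_le : (forall i, 0 < f i) ->
  forall y, \sum_i phi i y / f i <= n%:R.
Proof.
move=> f0 y; apply: sum_ln_first_order => // t t0 t2.
have t1 : 0 <= 1 - t by lra.
have := G_npmle (contaminate G (y : borel_space R d) t (ltW t0) t1).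
rewrite /avg_loglik ler_pM2l ?invr_gt0 ?ltr0n//; congr (_ <= _).
apply: eq_bigr => i _; congr ln.
rewrite /mixture_density Rintegral_contaminate//.
  by move=> z; exact/ltW/phi_gt0.
exact: phi_integrable.
Qed.

(** Otherwise the nonnegative continuous function [h] is positive at a support point and has
    positive integral, whereas that integral is [n - n]. *)
Lemma npmle_gradient_support x : (forall i, 0 < f i) -> msupport G x ->
  n%:R <= \sum_i phi i x / f i.
Proof.
move=> f0 Gx; rewrite leNgt; apply/negP => D_lt.
pose h y := n%:R - \sum_i phi i y / f i.
have D_ge0 y : 0 <= \sum_i phi i y / f i.
  by apply: sumr_ge0 => i _; rewrite divr_ge0// ltW.
have Dterm i : G.-integrable setT
    (EFin \o ((fun y => phi i y / f i) : borel_space R d -> R)).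
  rewrite (_ : _ \o _ = fun y => ((phi i y)%:E * (f i)^-1%:E)%E).
    exact: (integrableZr measurableT (f i)^-1 (phi_integrable i G)).
  by apply/funext => y; rewrite /= EFinM.
have [Dint DE] := Rintegral_sum G (index_enum 'I_n) _ Dterm.
have : 0 < \int[G]_y h y.
  apply: (@Rintegral_support_gt0 _ _ G h n%:R x) => //; last by rewrite subr_gt0.
    move=> y; apply: (@continuousB R R^o 'cV[R]_d (cst n%:R)
      (fun z => \sum_i phi i z / f i)); first exact: cst_continuous.
    apply: continuous_sumr => i z; apply: (@continuousM R 'cV[R]_d (phi i)).
      exact: phi_continuous.
    exact: cst_continuous.
  by move=> y; rewrite subr_ge0 npmle_gradient_le//= gerBl.
have cint : G.-integrable setT (EFin \o (cst n%:R : borel_space R d -> R)).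
  apply: (@continuous_bounded_integrable _ _ G (cst n%:R) n%:R) => y.
    exact: cst_continuous.
  by rewrite /= ger0_norm.
rewrite /h RintegralB// DE Rintegral_cst//.
have -> : fine (G setT) = 1 by rewrite probability_setT.
rewrite mulr1.
rewrite (eq_bigr (fun=> 1)) ?sumr_const ?card_ord ?subrr ?ltxx// => i _.
(* The integral of [phi i] against [G] is [f i] by definition, so each summand integrates to 1. *)
rewrite RintegralZr//; last exact: phi_integrable.
exact: (divff (lt0r_neq0 (f0 i))).
Qed.

Lemma npmle_support_ridgeline : msupport G `<=` ridgeline X Sigma.
Proof.
move=> x Gx; have f0 i : 0 < f i by exact: f_gt0 Gx.
pose w i := phi i x / f i.
have w0 i : 0 <= w i by rewrite divr_ge0 ?ltW.
have wn : n%:R <= \sum_i w i := npmle_gradient_support x f0 Gx.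
apply: (ridgeline_weights _ _ Sigma_posdef w) => //.
  by apply: lt_le_trans wn; rewrite ltr0n.
(* The residual [v] of the ridge equation serves as the test direction: along it the gradient
   function grows by at least [t * dot v v] minus a multiple of [t ^+ 2], yet it stays below [n],
   which forces [v = 0]. *)
set v := \sum_i _; apply/eqP; rewrite -dot_eq0 eq_le dot_ge0 andbT.
apply: (linear_le_quadratic_le0 _
  (\sum_i w i * (dot v (invmx (Sigma i) *m v) / 2))) => t _ _.
have := npmle_gradient_le f0 (x + t *: v).
have : \sum_i w i * (1 + t * dot v (invmx (Sigma i) *m (X i - x))
    - t ^+ 2 * (dot v (invmx (Sigma i) *m v) / 2)) <=
    \sum_i phi i (x + t *: v) / f i.
  apply: ler_sum => i _; rewrite mulrAC ler_pdivrMr// divfK ?gt_eqF//.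
  exact: gauss_density_line_ge.
have -> : \sum_i w i * (1 + t * dot v (invmx (Sigma i) *m (X i - x))
    - t ^+ 2 * (dot v (invmx (Sigma i) *m v) / 2)) =
    \sum_i w i + t * dot v v
    - t ^+ 2 * \sum_i w i * (dot v (invmx (Sigma i) *m v) / 2).
  rewrite {3}/v dot_sumr !mulr_sumr -big_split -sumrB; apply: eq_bigr => i _.
  by rewrite dotZr/=; ring.
lra.
Qed.

End Npmle.

Theorem proposition4 (R : realType) (n d : nat) (n_gt0 : (0 < n)%N)
    (d_gt0 : (0 < d)%N) (X : 'I_n -> 'cV[R]_d) (Sigma : 'I_n -> 'M[R]_d)
    (Sigma_posdef : forall i, posdef (Sigma i)) :
  (* the support of every maximizer lies in the ridgeline manifold *)
  (forall G : probability (borel_space R d) R,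
     is_npmle X Sigma G -> msupport G `<=` ridgeline X Sigma)
  /\
  (* 1. *)
  ((exists S : 'M[R]_d, forall i, Sigma i = S) \/
   (exists (c : 'I_n -> R) (S : 'M[R]_d),
      [/\ forall i, 0 < c i, posdef S & forall i, Sigma i = c i *: S]) ->
   ridgeline X Sigma = conv_hull [set X i | i in [set: 'I_n]])
  /\
  (* 2. *)
  ((forall i, is_diag_mx (Sigma i)) ->
   ridgeline X Sigma `<=`
     [set y : 'cV[R]_d | forall j : 'I_d,
        \big[Num.min/X (Ordinal n_gt0) j 0]_(i < n) X i j 0 <= y j 0 <=
        \big[Num.max/X (Ordinal n_gt0) j 0]_(i < n) X i j 0])
  /\
  (* 3. *)
  (forall (k_lo k_hi r : R) (x0 : 'cV[R]_d),
     0 < k_lo -> k_lo <= k_hi ->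
     (forall i, loewner_le k_lo%:M (Sigma i) /\
                loewner_le (Sigma i) k_hi%:M) ->
     0 < r -> (forall i, enorm (X i - x0) <= r) ->
     ridgeline X Sigma `<=` [set y : 'cV[R]_d | enorm (y - x0) <= k_hi / k_lo * r]).
Proof.
split; first exact: npmle_support_ridgeline.
split.
  move=> [[S SigmaE]|[c [S [c0 Spd SigmaE]]]]; last first.
    exact: (ridgeline_proportional _ _ Sigma_posdef c S).
  (* A common covariance is the case of unit factors; since [n] is positive, index 0 exists and
     shows [S] positive definite. *)
  apply: (ridgeline_proportional _ _ Sigma_posdef (fun=> 1) S) => // [|i].
    by rewrite -(SigmaE (Ordinal n_gt0)).
  by rewrite scale1r.
split.
  move=> Sdiag _ [a aS <-] j; apply/andP; split.
    apply: ridgeline_diag_ge => // i; exact: bigmin_le.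
  apply: ridgeline_diag_le => // i; exact: (le_bigmax _ (fun i => X i j 0) i).
move=> k_lo k_hi r x0 lo0 lohi Sk r0 Xr _ [a aS <-].
exact: ridgeline_ball.
Qed.
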